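(* Let $n\ge 2$. For every $\epsilon>0$ there is a constant $C_\epsilon$ (depending only on $\epsilon$ and $n$) such that the following holds. Let $N_1,\dots,N_n$ be natural numbers, and let $l_{j,a}$ ($j=1,\dots,n$, $a=1,\dots,N_j$) be lines in $\mathbb{R}^n$ such that each line $l_{j,a}$ makes an angle of at most $(10n)^{-1}$ with the $x_j$-axis. Let $T_{j,a}$ be the characteristic function of the $1$-neighborhood of $l_{j,a}$. Then for every $S\ge 1$ and every cube $Q_S\subset\mathbb{R}^n$ of side length $S$, $$\int_{Q_S}\prod_{j=1}^n\left(\sum_{a=1}^{N_j}T_{j,a}\right)^{\frac{1}{n-1}}\le C_\epsilon S^\epsilon\prod_{j=1}^n N_j^{\frac{1}{n-1}}.$$
   Context: The $W$-neighborhood of a set is the set of points at Euclidean distance at most $W$ from it. The angle between a line and the $x_j$-axis is the (unoriented) angle in $[0,\pi/2]$ between their directions. The lines $l_{j,a}$ need not be distinct. *)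

(* Defs.v *)
From HB Require Import structures.
From mathcomp Require Import all_boot all_order all_algebra.
From mathcomp Require Import all_classical all_reals all_analysis.

Set Implicit Arguments.
Unset Strict Implicit.
Unset Printing Implicit Defensive.

Import Order.TTheory GRing.Theory Num.Theory.
Import numFieldNormedType.Exports.
Local Open Scope classical_set_scope.
Local Open Scope ring_scope.

(* R^n is 'rV[R]_n, with the product sigma-algebra of the Borel sets of R, as
   for n.-tuple R. *)
Definition rV_display : measure_display -> measure_display.
Proof. exact. Qed.

Section rV_measurable.
Context {d} {T : measurableType d} (n : nat).

Let coord (i : 'I_n) (x : 'rV[T]_n) : T := x ord0 i.

Let rV_set0 : g_sigma_preimage coord set0.
Proof. exact: sigma_algebra0. Qed.

Let rV_setC A : g_sigma_preimage coord A -> g_sigma_preimage coord (~` A).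
Proof. exact: sigma_algebraC. Qed.

Let rV_bigcup (F : _^nat) : (forall i, g_sigma_preimage coord (F i)) ->
  g_sigma_preimage coord (\bigcup_i (F i)).
Proof. exact: sigma_algebra_bigcup. Qed.

HB.instance Definition _ := @isMeasurable.Build (rV_display d)
  'rV[T]_n (g_sigma_preimage coord) rV_set0 rV_setC rV_bigcup.

Lemma measurable_rV_coord (i : 'I_n) :
  measurable_fun [set: 'rV[T]_n] (fun x : 'rV[T]_n => x ord0 i).
Proof.
move=> _ Y mY; rewrite setTI; apply: sub_sigma_algebra => /=.
rewrite -bigcup_seq/=; exists i => /=; first by rewrite mem_index_enum.
by exists Y => //; rewrite setTI.
Qed.

Lemma measurable_fun_rVP d1 (T1 : measurableType d1) (f : T1 -> 'rV[T]_n) :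
  (forall i, measurable_fun [set: T1] (fun x => f x ord0 i)) ->
  measurable_fun [set: T1] f.
Proof.
move=> mf _ A mA; rewrite setTI.
suff : g_sigma_preimage coord `<=` [set A | measurable (f @^-1` A)].
  exact.
apply: smallest_sub.
  split => /=; first by rewrite preimage_set0.
  - by move=> B mB; rewrite setTD preimage_setC; exact: measurableC.
  - by move=> F mF; rewrite preimage_bigcup; exact: bigcupT_measurable.
move=> B; rewrite -bigcup_seq/= => -[i _ [Y mY <-]] /=.
by rewrite setTI; have := mf i measurableT Y mY; rewrite setTI.
Qed.

End rV_measurable.

Section lebesgue_rV.
Context {R : realType}.
Local Open Scope ereal_scope.

Definition consrV n (x : R * 'rV[R]_n) : 'rV[R]_n.+1 :=
  \row_i if unlift ord0 i is Some j then x.2 ord0 j else x.1.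

Definition unconsrV n (x : 'rV[R]_n.+1) : R * 'rV[R]_n :=
  (x ord0 ord0, \row_j x ord0 (lift ord0 j)).

Lemma consrVK n : cancel (@consrV n) (@unconsrV n).
Proof.
move=> [a x]; rewrite /unconsrV mxE unlift_none; congr pair.
by apply/rowP => j; rewrite !mxE liftK.
Qed.

Lemma unconsrVK n : cancel (@unconsrV n) (@consrV n).
Proof.
move=> x; apply/rowP => i; rewrite mxE.
by case: unliftP => [j ->|->]; rewrite ?mxE.
Qed.

Lemma measurable_consrV n : measurable_fun setT (@consrV n).
Proof.
apply: measurable_fun_rVP => i.
case: (unliftP ord0 i) => [j ->|->].
  rewrite (_ : (fun x => _) = (fun x : 'rV[R]_n => x ord0 j) \o snd).
    apply: measurableT_comp; first exact: measurable_rV_coord.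
    exact: measurable_snd.
  by apply/funext => x /=; rewrite mxE liftK.
rewrite (_ : (fun x => _) = fst); first exact: measurable_fst.
by apply/funext => x /=; rewrite mxE unlift_none.
Qed.

Lemma measurable_unconsrV n : measurable_fun setT (@unconsrV n).
Proof.
apply/measurable_fun_pairP; split; first exact: measurable_rV_coord.
apply: measurable_fun_rVP => i; rewrite (_ : (fun x => _) =
  (fun x : 'rV[R]_n.+1 => x ord0 (lift ord0 i))).
  exact: measurable_rV_coord.
by apply/funext => x /=; rewrite mxE.
Qed.

Let ex_sigma_finite_measure d (T : measurableType d) (q : set T -> \bar R) :
  q set0 = 0 -> (forall A, 0 <= q A) -> semi_sigma_additive q ->
  sigma_finite setT q ->
  exists mu : {sigma_finite_measure set T -> \bar R}, mu = q :> (_ -> _).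
Proof.
move=> q0 qge0 qsa qsf.
pose Q1 := isMeasure.Build _ _ _ q q0 qge0 qsa.
pose Q2 : {measure set T -> \bar R} := HB.pack q Q1.
pose Q3 := Measure_isSigmaFinite.Build _ _ _ Q2 qsf.
pose Q4 : {sigma_finite_measure set T -> \bar R} :=
  HB.pack (Measure.sort Q2) Q3.
by exists Q4.
Qed.

Fixpoint lebesgue_rV n : set 'rV[R]_n -> \bar R :=
  if n isn't m.+1 then \d_(0%R : 'rV[R]_0)
  else pushforward (lebesgue_measure \x @lebesgue_rV m) (@consrV m).

Let lebesgue_rV_sigma_finite_measure n :
  exists mu : {sigma_finite_measure set 'rV[R]_n -> \bar R},
    mu = @lebesgue_rV n :> (_ -> _).
Proof.
elim: n => [|n [mu muE]].
  by exists (\d_(0%R : 'rV[R]_0) : {sigma_finite_measure set _ -> \bar _}).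
pose p : {measure set (measurableTypeR R * 'rV[R]_n)%type -> \bar R} :=
  lebesgue_measure \x mu.
pose q := pushforward p (@consrV n).
have mpre A : measurable A -> measurable (@consrV n @^-1` A).
  by move=> mA; rewrite -[X in measurable X]setTI; exact: measurable_consrV.
have q0 : q set0 = 0 by rewrite /q /pushforward preimage_set0 measure0.
have qge0 A : 0 <= q A by exact: (measure_ge0 p).
have qsa : semi_sigma_additive q.
  move=> F mF tF mUF; rewrite /q /pushforward preimage_bigcup.
  apply: measure_semi_sigma_additive.
  - by move=> i; exact: mpre.
  - apply/trivIsetP => /= i j _ _ ij; rewrite -preimage_setI.
    by move/trivIsetP : tF => /(_ _ _ _ _ ij) ->//; rewrite preimage_set0.
  - by rewrite -preimage_bigcup; exact: mpre.
have qsf : sigma_finite setT q.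
  (* The SigmaFiniteMeasure instance of m1 \x m2 is not inferred: the one for
     subprobabilities takes precedence. *)
  have [F FT mF] : sigma_finite setT p.
    have /sigma_finiteP[F [TF ndF Foo]] := sigma_finiteT (@lebesgue_measure R).
    have /sigma_finiteP[G [TG ndG Goo]] := sigma_finiteT mu.
    exists (fun n => F n `*` G n).
      rewrite -setXTT TF TG predeqE => -[x y]; split.
        move=> [/= [k _ Fkx] [l _ Gly]]; exists (maxn k l) => //; split.
        - by move: x Fkx; exact/subsetPset/ndF/leq_maxl.
        - by move: y Gly; exact/subsetPset/ndG/leq_maxr.
      by move=> [k _ []/= ? ?]; split; exists k.
    move=> k; have [? ?] := Foo k; have [? ?] := Goo k.
    split; first exact: measurableX.
    by rewrite /p/= product_measure1E// lte_mul_pinfty// ge0_fin_numE.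
  exists (fun k => @unconsrV n @^-1` F k).
    by rewrite -preimage_bigcup -FT preimage_setT.
  move=> k; have [mFk pFk] := mF k; split.
    by rewrite -[X in measurable X]setTI; exact: measurable_unconsrV.
  rewrite /q /pushforward -comp_preimage.
  rewrite (_ : _ \o _ = id)//; apply/funext => x /=; exact: consrVK.
have [nu nuE] := ex_sigma_finite_measure q0 qge0 qsa qsf.
by exists nu; rewrite nuE /q /p /= muE.
Qed.

Section instances.
Variable n : nat.

Let lebesgue_rV0 : @lebesgue_rV n set0 = 0.
Proof.
by have [mu <-] := lebesgue_rV_sigma_finite_measure n; exact: measure0.
Qed.

Let lebesgue_rV_ge0 A : 0 <= @lebesgue_rV n A.
Proof.
by have [mu <-] := lebesgue_rV_sigma_finite_measure n; exact: measure_ge0.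
Qed.

Let lebesgue_rV_sigma_additive : semi_sigma_additive (@lebesgue_rV n).
Proof.
have [mu <-] := lebesgue_rV_sigma_finite_measure n.
exact: measure_semi_sigma_additive.
Qed.

HB.instance Definition _ := isMeasure.Build _ _ _ (@lebesgue_rV n)
  lebesgue_rV0 lebesgue_rV_ge0 lebesgue_rV_sigma_additive.

Let lebesgue_rV_sigma_finite : sigma_finite setT (@lebesgue_rV n).
Proof.
by have [mu <-] := lebesgue_rV_sigma_finite_measure n; exact: sigma_finiteT.
Qed.

HB.instance Definition _ := Measure_isSigmaFinite.Build _ _ _ (@lebesgue_rV n)
  lebesgue_rV_sigma_finite.

End instances.

Lemma lebesgue_rV_box n (A : 'I_n -> set R) : (forall i, measurable (A i)) ->
  lebesgue_rV [set x : 'rV[R]_n | forall i, A i (x ord0 i)] =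
  \prod_(i < n) lebesgue_measure (A i).
Proof.
elim: n A => [|n IHn] A mA.
  rewrite big_ord0 /= diracE mem_set//=.
  by case.
rewrite big_ord_recl -IHn// /= /pushforward.
set B := [set x : 'rV[R]_n | forall i, A (lift ord0 i) (x ord0 i)].
have mB : measurable B.
  have -> : B = \bigcap_(i in [set: 'I_n])
      ((fun x : 'rV[R]_n => x ord0 i) @^-1` A (lift ord0 i)).
    by apply/seteqP; split => x /= h i *; exact: h.
  apply: fin_bigcap_measurable => // i _.
  rewrite -[X in measurable X]setTI.
  exact: measurable_rV_coord.
have -> : @consrV n @^-1` [set x | forall i, A i (x ord0 i)] = A ord0 `*` B.
  apply/seteqP; split=> -[a x] /= => [h|[h0 h] i].
    split; first by have := h ord0; rewrite mxE unlift_none.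
    by move=> i; have := h (lift ord0 i); rewrite mxE liftK.
  by rewrite mxE; case: unliftP => [j ->|->].
by rewrite product_measure1E//; exact: mA.
Qed.

End lebesgue_rV.
Arguments lebesgue_rV : clear implicits.

Section euclidean.
Context {R : realType} {n : nat}.

Definition dotrV (u v : 'rV[R]_n) : R := \sum_(i < n) u ord0 i * v ord0 i.

(* The norm `|u| of the library on 'rV[R]_n is the sup norm. *)
Definition enorm (u : 'rV[R]_n) : R := Num.sqrt (dotrV u u).

(* Extended-real valued, so that the empty set is at distance +oo. *)
Definition edist (x : 'rV[R]_n) (A : set 'rV[R]_n) : \bar R :=
  ereal_inf [set (enorm (x - y))%:E | y in A].

Definition nbhd (W : R) (A : set 'rV[R]_n) : set 'rV[R]_n :=
  [set x | (edist x A <= W%:E)%E].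

(* The closed cubes of side length S, with arbitrary position and orientation. *)
Definition is_cube (S : R) (Q : set 'rV[R]_n) : Prop :=
  exists (c : 'rV[R]_n) (O : 'M[R]_n), O *m O^T = 1%:M /\
    Q = [set c + t *m O |
          t in [set t : 'rV[R]_n | forall i, 0 <= t ord0 i <= S]].

End euclidean.

Record line (R : realType) (n : nat) := Line {
  line_base : 'rV[R]_n;
  line_dir : 'rV[R]_n;
  line_dir_neq0 : line_dir != 0
}.

Section lines.
Context {R : realType} {n : nat}.

Definition line_points (l : line R n) : set 'rV[R]_n :=
  range (fun t : R => line_base l + t *: line_dir l).

Definition angle (l m : line R n) : R :=
  acos (`|dotrV (line_dir l) (line_dir m)| /
        (enorm (line_dir l) * enorm (line_dir m))).

Lemma axis_dir_neq0 (j : 'I_n) : delta_mx ord0 j != 0 :> 'rV[R]_n.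
Proof.
apply/eqP => /rowP/(_ j)/eqP; rewrite !mxE !eqxx/=.
by rewrite oner_eq0.
Qed.

Definition axis (j : 'I_n) : line R n := Line 0 (axis_dir_neq0 j).

End lines.

(* Main.v *)
Require Import Defs.
From HB Require Import structures.
From mathcomp Require Import all_boot all_order all_algebra.
From mathcomp Require Import all_classical all_reals all_analysis.
From mathcomp Require Import measurable_realfun.
From mathcomp Require Import ring lra zify.

(** Multilinear Kakeya is reduced to a statement about finite sets of grid
    points, which is proved by induction on scales, after Guth.

    Grid version.  Call a set A of points of the grid {0, .., m - 1}^n roughly
    Lipschitz over the j-th axis when any two of its points p, q satisfy
    |p_i - q_i| <= C + |p_j - q_j| / L for all i <> j.  A discretised tube whose
    direction is within about 1/L of the j-th axis has this property.  Two facts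
    make it the right notion.
    - It is stable under passing to the grid of cells of side L, with the same
      C and L ([rough_lip_coarse]): the error C is divided by L, which leaves
      room for the rounding error.
    - Inside one cell, |p_j - q_j| < L, so A moves by at most C + 1 in the
      directions i <> j: up to a constant depending on C, it is an axis-parallel
      segment.  The Loomis-Whitney inequality ([loomis_whitney]) then bounds the
      sum of the product over a cell by a constant K times the product of the
      powers of the numbers of sets meeting the cell ([kakeya_sum_thin]).
    Hence going from one scale to the next costs a factor K, and a grid of side
    L ^ M is a single point after M steps: the sum is at most
    K ^ M \prod_j N_j ^ (1 / (n - 1)) ([kakeya_sum_multiscale]).  Since K does
    not depend on L, one may choose L with K <= L ^ eps, and then
    K ^ M <= (L ^ M) ^ eps, which is S ^ eps up to a constant.

    Reduction.  The tubes come with angles up to 1 / (10 n) rather than 1 / L.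
    Their slopes are sorted into finitely many caps of size 1 / (4 L), and the
    integrand is at most the sum, over the choices of one cap for each axis, of
    the integrands with only the tubes of these caps ([sum_caps_le]), because
    t |-> t ^ (1 / (n - 1)) is subadditive.  For one choice of caps, the grid is
    taken along one slope from each cap.  The matrix V of these slopes is close
    to the identity ([near_identity_bound]), so the coordinates in this frame
    are comparable to the original ones, with constants independent of L, and in
    them each tube is almost parallel to its axis ([rough_lip_trace]).  The cube
    is covered by boxes of bounded size around the grid points, so the integral
    is at most a constant times the grid sums ([kakeya_integral_le]). *)

Set Implicit Arguments.
Unset Strict Implicit.
Unset Printing Implicit Defensive.

Import Order.TTheory GRing.Theory Num.Theory.
Import numFieldNormedType.Exports.
Local Open Scope classical_set_scope.
Local Open Scope ring_scope.

(** * Powers and the Hoelder inequality *)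

Section Powers.
Context {R : realType}.

Lemma prod_powR (I : finType) (P : pred I) (g : I -> R) (r : R) :
  (forall j, P j -> 0 <= g j) ->
  \prod_(j | P j) g j `^ r = (\prod_(j | P j) g j) `^ r.
Proof.
move=> g0.
suff [] : \prod_(j | P j) g j `^ r = (\prod_(j | P j) g j) `^ r /\
  0 <= \prod_(j | P j) g j by [].
elim/big_ind2 : _ => [|x y z t [-> y0] [-> t0]|j Pj].
- by rewrite powR1.
- by rewrite powRM // mulr_ge0.
- by split=> //; exact: g0.
Qed.

Lemma AGM_powR (J : finType) (P : pred J) (g : J -> R) :
  (0 < #|P|)%N -> (forall j, P j -> 0 <= g j) ->
  \prod_(j | P j) g j `^ #|P|%:R^-1 <= (\sum_(j | P j) g j) / #|P|%:R.
Proof.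
move=> P0 g0; rewrite prod_powR //.
have k0 : 0 < #|P|%:R :> R by rewrite ltr0n.
have A0 : 0 <= (\sum_(j | P j) g j) / #|P|%:R.
  by apply: divr_ge0; [exact: sumr_ge0|exact: ltW].
have /= /leifP := @leif_AGM R J P g g0.
have -> : (\sum_(i in P) g i) = \sum_(j | P j) g j by [].
have -> : (\prod_(i in P) g i) = \prod_(j | P j) g j by [].
move=> H.
have {}H : \prod_(j | P j) g j <= ((\sum_(j | P j) g j) / #|P|%:R) ^+ #|P|.
  by move: H; case: ifP => _ => [/eqP ->|/ltW].
apply: (@le_trans _ _ ((((\sum_(j | P j) g j) / #|P|%:R) ^+ #|P|) `^ #|P|%:R^-1)).
  apply: ge0_ler_powR => //.
    by rewrite nnegrE prodr_ge0.
  by rewrite nnegrE exprn_ge0.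
by rewrite -powR_mulrn // -powRrM divff ?gt_eqF // powRr1.
Qed.

(** After normalising each g j to have sum 1, the product of the roots is at
    most the arithmetic mean, whose sum over t is 1. *)
Lemma holder_sum (T J : finType) (P : pred J) (g : J -> T -> R) :
  (0 < #|P|)%N -> (forall j t, 0 <= g j t) ->
  \sum_t \prod_(j | P j) g j t `^ #|P|%:R^-1 <=
  \prod_(j | P j) (\sum_t g j t) `^ #|P|%:R^-1.
Proof.
move=> P0 g0; set r := #|P|%:R^-1.
have k0 : 0 < #|P|%:R :> R by rewrite ltr0n.
have G0 j : 0 <= \sum_t g j t by apply: sumr_ge0.
have [/existsP[j /andP[Pj /eqP Gj]]|] :=
    boolP [exists j, P j && (\sum_t g j t == 0)].
  rewrite big1 ?prodr_ge0 // => [i _|t _]; first exact: powR_ge0.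
  rewrite (bigD1 j) //= (_ : g j t = 0) ?powR0 ?mul0r ?invr_eq0 ?gt_eqF //.
  by apply/eqP; move/eqP: Gj;
    rewrite psumr_eq0 // => /allP/(_ t (mem_index_enum _)).
rewrite negb_exists => /forallP Gn0.
have Gpos j : P j -> 0 < \sum_t g j t.
  by move=> Pj; rewrite lt_def G0 andbT; have := Gn0 j; rewrite Pj.
have E t : \prod_(j | P j) g j t `^ r =
    \prod_(j | P j) (\sum_t g j t) `^ r *
    \prod_(j | P j) (g j t / \sum_t g j t) `^ r.
  rewrite -big_split /=; apply: eq_bigr => j Pj.
  by rewrite -powRM ?divr_ge0 // mulrC divfK // gt_eqF // Gpos.
rewrite (eq_bigr _ (fun t _ => E t)) -mulr_sumr ler_piMr //.
  by apply: prodr_ge0 => j _; exact: powR_ge0.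
apply: (@le_trans _ _ (\sum_t (\sum_(j | P j) (g j t / \sum_t g j t)) / #|P|%:R)).
  apply: ler_sum => t _; apply: AGM_powR => // j Pj; exact: divr_ge0.
rewrite -mulr_suml exchange_big /= ler_pdivrMr // mul1r.
rewrite (eq_bigr (fun=> 1)) ?sumr_const // => j Pj.
by rewrite -mulr_suml divff ?gt_eqF ?Gpos.
Qed.
(** For t in [0, a + b] one has t / (a + b) <= (t / (a + b)) ^ r as r <= 1; add
    this for t = a and t = b. *)
Lemma powR_subadd (r a b : R) : 0 < r -> r <= 1 -> 0 <= a -> 0 <= b ->
  (a + b) `^ r <= a `^ r + b `^ r.
Proof.
move=> r0 r1 a0 b0; have [ab0|ab0] := eqVneq (a + b) 0.
  by rewrite ab0 powR0 ?gt_eqF // addr_ge0 // powR_ge0.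
have ab : 0 < a + b by rewrite lt_def ab0 addr_ge0.
have K t : 0 <= t -> t <= a + b -> t / (a + b) * (a + b) `^ r <= t `^ r.
  move=> t0 tab; have [->|tn0] := eqVneq t 0; first by rewrite !mul0r powR_ge0.
  have tp : 0 < t by rewrite lt_def tn0.
  rewrite -[in leRHS](divfK ab0 t) powRM ?divr_ge0 ?(ltW ab) // ler_wpM2r ?powR_ge0 //.
  by rewrite ger1_powR // divr_gt0 //= ler_pdivrMr // mul1r.
have := lerD (K a a0 _) (K b b0 _).
by rewrite -mulrDl -mulrDl divff // mul1r; apply; rewrite ?lerDl ?lerDr.
Qed.

Lemma powR_sum_le (r : R) (I : finType) (g : I -> R) : 0 < r -> r <= 1 ->
  (forall i, 0 <= g i) -> (\sum_i g i) `^ r <= \sum_i g i `^ r.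
Proof.
move=> r0 r1 g0.
suff [] : (\sum_i g i) `^ r <= \sum_i g i `^ r /\ 0 <= \sum_i g i by [].
elim/big_rec2 : _ => [|i x y _ [h x0]]; first by rewrite powR0 // gt_eqF.
split; last exact: addr_ge0.
by apply: le_trans (powR_subadd r0 r1 (g0 i) x0) _; rewrite lerD2l.
Qed.

Lemma exists_scale (eps K : R) : 0 < eps -> 0 <= K ->
  exists2 L, (1 < L)%N & K <= L%:R `^ eps.
Proof.
move=> e0 K0; have en0 : eps != 0 by rewrite gt_eqF.
exists (Num.truncn (K `^ eps^-1)).+2 => //.
rewrite [leLHS](_ : K = (K `^ eps^-1) `^ eps);
  last by rewrite -powRrM mulVf // powRr1.
apply: ge0_ler_powR; rewrite ?nnegrE ?powR_ge0 ?(ltW e0) //.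
apply: ltW; apply: (@lt_le_trans _ _ ((Num.truncn (K `^ eps^-1)).+1%:R)).
  exact: truncnS_gt.
by rewrite ler_nat.
Qed.

(** The grid side L ^ M exceeds s by a factor at most L. *)
Lemma exists_power (L : nat) (s : R) : (1 < L)%N -> 1 <= s ->
  exists M, s < (L ^ M)%:R <= L%:R * s.
Proof.
move=> L1 s1; have s0 : 0 <= s by lra.
have N0 : (0 < Num.truncn s)%N by rewrite truncn_ge_nat.
have /andP[h1 h2] := trunc_log_bounds L1 N0.
exists (trunc_log L (Num.truncn s)).+1; apply/andP; split.
  by apply: lt_le_trans (truncnS_gt s) _; rewrite ler_nat.
rewrite expnS natrM ler_wpM2l //; apply: (@le_trans _ _ ((Num.truncn s)%:R)).
  by rewrite ler_nat.
by rewrite truncn_le.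
Qed.
End Powers.

(** * The discrete Loomis-Whitney inequality *)

Section LoomisWhitney.
Context {R : realType} {n : nat} {T : finType}.
Implicit Types (x y : {ffun 'I_n -> T}) (s : seq 'I_n) (f : {ffun 'I_n -> T} -> R).

Definition upd x (i : 'I_n) (t : T) : {ffun 'I_n -> T} :=
  [ffun k => if k == i then t else x k].

(** Integration of f over the coordinates in s, the other ones being frozen to
    those of x; it allows coordinates to be integrated one at a time. *)
Definition slice_sum s f x : R :=
  \sum_(y : {ffun _ -> T} | [forall k, (k \notin s) ==> (y k == x k)]) f y.

Lemma slice_sum_nil f x : slice_sum [::] f x = f x.
Proof.
rewrite /slice_sum (big_pred1 x) // => y /=.
apply/forallP/eqP => [h|-> //].
by apply/ffunP => k; exact/eqP/h.
Qed.

Lemma slice_sum_cons i s f x : i \notin s ->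
  slice_sum (i :: s) f x = \sum_t slice_sum s f (upd x i t).
Proof.
move=> si;
  rewrite /slice_sum (partition_big (fun y : {ffun 'I_n -> T} => y i) predT) //=.
apply: eq_bigr => t _; apply: eq_bigl => y.
apply/andP/forallP => [[/forallP h /eqP yi] k|h].
  apply/implyP => sk; rewrite ffunE; have [->|ki] := eqVneq k i;
    first by rewrite yi.
  by have := h k; rewrite inE negb_or ki sk.
split.
  apply/forallP => k; apply/implyP; rewrite inE negb_or => /andP[/negbTE ki sk].
  by have := h k; rewrite sk ffunE ki.
by have := h i; rewrite si ffunE eqxx.
Qed.

Lemma slice_sum_ge0 s f x : (forall y, 0 <= f y) -> 0 <= slice_sum s f x.
Proof. by move=> f0; apply: sumr_ge0. Qed.

Lemma slice_sum_upd i t s f x : uniq s -> i \notin s ->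
  (forall y u, f (upd y i u) = f y) ->
  slice_sum s f (upd x i t) = slice_sum s f x.
Proof.
move=> + + fi; elim: s x => [|k s IHs] x /=; first by rewrite !slice_sum_nil fi.
move=> /andP[ks us]; rewrite inE negb_or => /andP[ik si].
rewrite !slice_sum_cons //; apply: eq_bigr => u _.
rewrite -(IHs (upd x k u)) //; congr (slice_sum s f _); apply/ffunP => h.
rewrite !ffunE; case: eqP => // ->; case: eqP => // /esym/eqP.
by rewrite (negbTE ik).
Qed.

(** Each f j is constant in coordinate j.  When coordinate i is integrated, f i
    comes out as a constant, so that Hoelder is applied to only n - 1 factors,
    which is what the exponent 1 / (n - 1) allows. *)
Lemma loomis_whitney_slice (f : 'I_n -> {ffun 'I_n -> T} -> R) s x :
  (1 < n)%N -> (forall j y, 0 <= f j y) ->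
  (forall j y u, f j (upd y j u) = f j y) -> uniq s ->
  slice_sum s (fun y => \prod_j f j y `^ n.-1%:R^-1) x <=
  \prod_j slice_sum [seq i <- s | i != j] (f j) x `^ n.-1%:R^-1.
Proof.
move=> n1 f0 fj; elim: s x => [|i s IHs] x /=.
  move=> _; rewrite slice_sum_nil; apply: ler_prod => j _.
  by rewrite powR_ge0 slice_sum_nil /=.
move=> /andP[si us]; rewrite slice_sum_cons //.
apply: (le_trans (ler_sum _ (fun t _ => IHs (upd x i t) us))).
have nP : #|[pred j | j != i]| = n.-1.
  by have := cardC1 i; rewrite card_ord => <-; apply: eq_card.
have n0 : (0 < #|[pred j | j != i]|)%N by rewrite nP; case: (n) n1 => [|[]].
have fil j : i != j -> i \notin [seq k <- s | k != j].
  by rewrite mem_filter (negbTE si) andbF.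
rewrite [leRHS](bigD1 i) //= eqxx /=.
set c := slice_sum [seq k <- s | k != i] (f i) x `^ n.-1%:R^-1.
have E t : \prod_j slice_sum [seq k <- s | k != j] (f j) (upd x i t) `^ n.-1%:R^-1 =
    c * \prod_(j | j != i) slice_sum [seq k <- s | k != j] (f j) (upd x i t) `^ n.-1%:R^-1.
  rewrite (bigD1 i) //=; congr (_ `^ _ * _); apply: slice_sum_upd.
  - exact: filter_uniq.
  - by rewrite mem_filter eqxx.
  - exact: fj.
rewrite (eq_bigr _ (fun t _ => E t)) -mulr_sumr ler_wpM2l ?powR_ge0 //.
have := @holder_sum R T _ [pred j | j != i]
  (fun j t => slice_sum [seq k <- s | k != j] (f j) (upd x i t)) n0.
rewrite nP /= => /(_ (fun j t => slice_sum_ge0 _ _ (f0 j))) H.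
apply: (le_trans H); rewrite le_eqVlt; apply/orP; left; apply/eqP.
apply: eq_bigr => j ji; rewrite eq_sym ji slice_sum_cons //.
by apply: fil; rewrite eq_sym.
Qed.

Lemma loomis_whitney (f : 'I_n -> {ffun 'I_n -> T} -> R) x :
  (1 < n)%N -> (forall j y, 0 <= f j y) ->
  (forall j y u, f j (upd y j u) = f j y) ->
  \sum_y \prod_j f j y `^ n.-1%:R^-1 <=
  \prod_j (\sum_(y : {ffun 'I_n -> T} | y j == x j) f j y) `^ n.-1%:R^-1.
Proof.
move=> n1 f0 fj.
have := loomis_whitney_slice x n1 f0 fj (enum_uniq 'I_n).
rewrite {1}/slice_sum [in leLHS](eq_bigl xpredT); last first.
  by move=> y /=; apply/forallP => k; rewrite mem_enum.
move=> /le_trans; apply; rewrite le_eqVlt; apply/orP; left; apply/eqP.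
apply: eq_bigr => j _; congr (_ `^ _); apply: eq_bigl => y.
apply/forallP/idP => [/(_ j)|yj k]; first by rewrite mem_filter eqxx.
by apply/implyP; rewrite mem_filter mem_enum andbT negbK => /eqP ->.
Qed.
End LoomisWhitney.

(** * Sets which are thin off one axis *)

Section Counting.
Context {n m : nat}.
Local Notation pt := {ffun 'I_n -> 'I_m}.
Implicit Types (B : {set pt}) (p q x y : pt).

Definition thin (C : nat) (j : 'I_n) B := forall p q, p \in B -> q \in B ->
  forall i, i != j -> (p i <= q i + C)%N.

(** The cylinder over the projection of B along the j-th axis.  Keeping it a set
    of points of the same grid spares a grid of dimension n - 1. *)
Definition shadow (j : 'I_n) B : {set pt} :=
  [set y : pt | [exists x in B, [forall i, (i != j) ==> (x i == y i)]]].

Lemma shadowP j B y : reflect (exists2 x, x \in B & forall i, i != j -> x i = y i)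
  (y \in shadow j B).
Proof.
rewrite inE; apply: (iffP existsP) => [[x /andP[xB /forallP h]]|[x xB h]].
  by exists x => // i ij; apply/eqP; exact: (implyP (h i)).
by exists x; rewrite xB; apply/forallP => i; apply/implyP => ij; apply/eqP/h.
Qed.

Lemma card_ord_window (lo C : nat) : (#|[pred u : 'I_m | lo <= u <= lo + C]| <= C.+1)%N.
Proof.
rewrite -sum1_card big_mkcond /=.
rewrite -(big_mkord xpredT (fun u => if (lo <= u <= lo + C)%N then 1%N else 0%N)).
rewrite -big_mkcond /= sum1_count -size_filter.
have : (size [seq u <- index_iota 0 m | lo <= u <= lo + C] <= size (index_iota lo (lo + C).+1))%N.
  apply: uniq_leq_size => [|u]; first by rewrite filter_uniq // iota_uniq.
  by rewrite mem_filter !mem_index_iota ltnS => /andP[].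
by rewrite size_iota => /leq_trans; apply; lia.
Qed.

(** With j-th coordinate fixed, every other coordinate of a point of the shadow
    is within C of that of any chosen point of B. *)
Lemma card_shadow_fiber C j B x0 : thin C j B ->
  (#|[pred y : pt | (y \in shadow j B) && (y j == x0 j)]| <= C.*2.+1 ^ n.-1)%N.
Proof.
move=> tB; have [->|[b bB]] := set_0Vmem B.
  by rewrite eq_card0 // => y; rewrite inE; apply/andP => -[/shadowP[x]];
    rewrite inE.
pose W (i : 'I_n) : {pred 'I_m} := if i == j then pred1 (x0 j)
  else [pred u : 'I_m | b i - C <= u <= b i - C + C.*2]%N.
apply: (@leq_trans #|family W|).
  apply: subset_leq_card; apply/fintype.subsetP => y.
  rewrite inE => /andP[/shadowP[x xB xy] /eqP yj].
  apply/familyP => i; rewrite /W; case: eqVneq => [->|ij];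
    first by rewrite inE yj.
  rewrite inE -xy //; have := tB _ _ xB bB _ ij; have := tB _ _ bB xB _ ij;
    move: (nat_of_ord (b i)) (nat_of_ord (x i)) => u v; lia.
rewrite card_family foldrE big_map big_enum /=.
rewrite (bigD1 j) //= /W eqxx card1 mul1n.
apply: (@leq_trans (\prod_(i < n | i != j) C.*2.+1)).
  by apply: leq_prod => i ij; rewrite (negbTE ij); exact: card_ord_window.
by rewrite prod_nat_const cardC1 card_ord.
Qed.

End Counting.

Section Multiscale.
Context {R : realType} {n : nat}.
Context (n1 : (1 < n)%N).

(** The grid counterpart of the integral to be estimated. *)
Definition kakeya_sum m (N : 'I_n -> nat)
    (A : forall j, 'I_(N j) -> {set {ffun 'I_n -> 'I_m}}) : R :=
  \sum_x \prod_j (\sum_(a < N j) (x \in A j a)%:R) `^ n.-1%:R^-1.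

(** Loomis-Whitney applied to the numbers of shadows through each point: the
    sum of the j-th one over a hyperplane orthogonal to the j-th axis is at most
    the number of nonempty sets times the size of a thin cross-section. *)
Lemma kakeya_sum_thin m C (N : 'I_n -> nat)
    (A : forall j, 'I_(N j) -> {set {ffun 'I_n -> 'I_m}}) :
  (forall j a, thin C j (A j a)) ->
  kakeya_sum A <= (C.*2.+1 ^ n)%:R *
    \prod_j (\sum_(a < N j) (A j a != finset.set0)%:R) `^ n.-1%:R^-1.
Proof.
move=> tA; pose r : R := n.-1%:R^-1.
have r0 : 0 <= r by rewrite invr_ge0.
have [x0 _|noX] := pickP (predT : pred {ffun 'I_n -> 'I_m}); last first.
  rewrite /kakeya_sum big1; last by move=> x; have := noX x.
  by rewrite mulr_ge0 // prodr_ge0 // => j _; exact: powR_ge0.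
pose f j (y : {ffun 'I_n -> 'I_m}) : R := \sum_(a < N j) (y \in shadow j (A j a))%:R.
have f0 j y : 0 <= f j y by apply: sumr_ge0.
have fj j y u : f j (upd y j u) = f j y.
  apply: eq_bigr => a _; congr (_%:R); congr (nat_of_bool _).
  by apply/shadowP/shadowP => -[x xA h]; exists x => // i ij;
    rewrite h // ffunE (negbTE ij).
apply: (@le_trans _ _ (\sum_y \prod_j f j y `^ r)).
  apply: ler_sum => x _; apply: ler_prod => j _; rewrite powR_ge0 /=.
  apply: ge0_ler_powR => //; rewrite ?nnegrE ?f0 //; first exact: sumr_ge0.
  apply: ler_sum => a _; rewrite ler_nat.
  case: (boolP (x \in A j a)) => //= xA.
  by rewrite lt0b; apply/shadowP; exists x.
apply: (le_trans (loomis_whitney x0 n1 f0 fj)).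
have -> : (C.*2.+1 ^ n)%:R = \prod_(j < n) ((C.*2.+1 ^ n.-1)%:R `^ r) :> R.
  rewrite prodr_const card_ord natrX; congr (_ ^+ n).
  rewrite natrX -powR_mulrn // -powRrM /r divff ?powRr1 //.
  by rewrite pnatr_eq0; case: (n) n1 => [|[]].
rewrite -big_split /=; apply: ler_prod => j _; rewrite powR_ge0 /=.
rewrite -powRM ?sumr_ge0 //.
have sh0 : 0 <= \sum_(y : {ffun 'I_n -> 'I_m} | y j == x0 j) f j y by apply: sumr_ge0.
apply: ge0_ler_powR => //; rewrite ?nnegrE //.
  by rewrite mulr_ge0 // sumr_ge0.
rewrite /f exchange_big /= mulr_sumr; apply: ler_sum => a _.
rewrite -natr_sum -natrM ler_nat.
have [A0|An0] := eqVneq (A j a) finset.set0.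
  rewrite muln0 leqn0; apply/eqP; apply: big1 => y _.
  by case: shadowP => // -[x]; rewrite A0 inE.
rewrite muln1; apply: leq_trans (card_shadow_fiber x0 (tA j a)).
rewrite -big_mkcondr /= sum1_card; apply: subset_leq_card;
  apply/fintype.subsetP => y.
by rewrite [in X in X -> _]unfold_in !inE andbC.
Qed.

(** * Induction on scales *)

(** |p_i - q_i| <= C + |p_j - q_j| / L, multiplied by L to stay in the natural
    numbers; the last two truncated differences add up to |p_j - q_j|. *)
Definition rough_lip m (L C : nat) (j : 'I_n) (A : {set {ffun 'I_n -> 'I_m}}) :=
  forall p q, p \in A -> q \in A -> forall i, i != j ->
  (L * p i <= L * q i + L * C + (p j - q j) + (q j - p j))%N.

Lemma coarse_subproof L M (u : 'I_(L ^ M.+1)) : (u %/ L < L ^ M)%N.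
Proof.
have L0 : (0 < L)%N by case: L u => // -[u]; rewrite exp0n.
by rewrite ltn_divLR // -expnSr.
Qed.

Definition coarse L M (x : {ffun 'I_n -> 'I_(L ^ M.+1)}) : {ffun 'I_n -> 'I_(L ^ M)} :=
  [ffun i => Ordinal (coarse_subproof (x i))].

(** Dividing by L turns the error C into C / L, and rounding to cells adds less
    than 1 in all; C / L + 1 <= C as soon as C and L are at least 2. *)
Lemma rough_lip_coarse L M C j (A : {set {ffun 'I_n -> 'I_(L ^ M.+1)}}) :
  (1 < L)%N -> (1 < C)%N -> rough_lip L C j A -> rough_lip L C j (@coarse L M @: A).
Proof.
move=> L1 C1 lA _ _ /imsetP[p pA ->] /imsetP[q qA ->] i ij.
have := lA p q pA qA i ij; rewrite !ffunE /=.
move: (nat_of_ord (p i)) (nat_of_ord (q i)) (nat_of_ord (p j)) (nat_of_ord (q j))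
    => pi qi pj qj.
have L0 : (0 < L)%N by lia.
have := divn_eq pi L; have := divn_eq qi L; have := divn_eq pj L;
  have := divn_eq qj L.
have := ltn_pmod pi L0; have := ltn_pmod qi L0; have := ltn_pmod pj L0;
  have := ltn_pmod qj L0.
move: (pi %/ L)%N (qi %/ L)%N (pj %/ L)%N (qj %/ L)%N
  (pi %% L)%N (qi %% L)%N (pj %% L)%N (qj %% L)%N.
move=> a b c d a' b' c' d' ha hb hc hd -> -> -> -> H.
have CL : (C + L <= L * C)%N by nia.
have K : ((c * L + c') - (d * L + d') + ((d * L + d') - (c * L + c')) <=
    L * ((c - d) + (d - c)) + L)%N by nia.
rewrite -(leq_pmul2l L0) -[(_ + (c - d) + _)%N]addnA; rewrite -addnA in H.
move: K H; move: (c - d + (d - c))%N => X.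
move: (_ - _ + _)%N => Y K H.
have LL : (L * (C + L) <= L * (L * C))%N by rewrite leq_pmul2l.
have : (L * b' + L <= L * L)%N by rewrite addnC -mulnS leq_pmul2l.
rewrite !mulnDr in LL H *; lia.
Qed.

(** Each scale costs the constant of the estimate for sets that are thin at
    width C + 1, whatever L is: this is what makes the loss S ^ eps. *)
Lemma kakeya_sum_multiscale L C M (N : 'I_n -> nat)
    (A : forall j, 'I_(N j) -> {set {ffun 'I_n -> 'I_(L ^ M)}}) :
  (1 < L)%N -> (1 < C)%N -> (forall j a, rough_lip L C j (A j a)) ->
  kakeya_sum A <= (C.*2.+3 ^ n)%:R ^+ M * \prod_j (N j)%:R `^ n.-1%:R^-1.
Proof.
move=> L1 C1; elim: M A => [|M IHM] A lA.
  rewrite expr0 mul1r /kakeya_sum.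
  have x0 : {ffun 'I_n -> 'I_(L ^ 0)} := [ffun=> ord0].
  rewrite (big_pred1 x0) => [|y]; last first.
    by apply/esym/eqP/ffunP => i; apply/val_inj;
      case: (y i) (x0 i) => [[]//] ? [[]].
  apply: ler_prod => j _; rewrite powR_ge0 /=.
  apply: ge0_ler_powR => //; rewrite ?invr_ge0 // ?nnegrE ?sumr_ge0 //.
  apply: (@le_trans _ _ (\sum_(a < N j) 1));
    last by rewrite sumr_const card_ord.
  by apply: ler_sum => a _; rewrite lern1 leq_b1.
pose K : R := (C.*2.+3 ^ n)%:R.
pose A' j a := @coarse L M @: A j a.
have := IHM A' (fun j a => rough_lip_coarse L1 C1 (lA j a)) => {}IHM.
rewrite exprS -mulrA; apply: (le_trans _ (ler_wpM2l _ IHM)) => //.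
rewrite /kakeya_sum (partition_big (@coarse L M) xpredT) //= mulr_sumr.
apply: ler_sum => y _.
(* The part of the sets lying in the cell of index y. *)
pose B j a := [set x in A j a | coarse x == y].
have tB j a : thin C.+1 j (B j a).
  move=> p q; rewrite !inE => /andP[pA /eqP py] /andP[qA /eqP qy] i ij.
  have := lA j a p q pA qA i ij.
  have : coarse p j = coarse q j by rewrite py qy.
  rewrite !ffunE => /(congr1 val) /=.
  move: (nat_of_ord (p i)) (nat_of_ord (q i)) (nat_of_ord (p j)) (nat_of_ord (q j))
    => pi qi pj qj.
  have L0 : (0 < L)%N by lia.
  have := divn_eq pj L; have := divn_eq qj L.
  have := ltn_pmod pj L0; have := ltn_pmod qj L0.
  move: (pj %/ L)%N (qj %/ L)%N (pj %% L)%N (qj %% L)%N.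
  move=> c d c' d' hc hd -> -> <- H.
  have : (L * pi < L * (qi + C + 1 + 1))%N by rewrite !mulnDr; lia.
  by rewrite ltn_pmul2l //; lia.
apply: (@le_trans _ _ (kakeya_sum B)).
  rewrite /kakeya_sum [leRHS](bigID (fun x => coarse x == y)) /=.
  rewrite -[leLHS]addr0 lerD //; last first.
    by apply: sumr_ge0 => x _; apply: prodr_ge0 => j _; exact: powR_ge0.
  apply: ler_sum => x xy; apply: ler_prod => j _; rewrite powR_ge0 /=.
  by under [in leRHS]eq_bigr => a _ do rewrite inE xy andbT.
apply: (le_trans (kakeya_sum_thin tB)); rewrite doubleS ler_wpM2l //.
apply: ler_prod => j _; rewrite powR_ge0 /=.
apply: ge0_ler_powR => //; rewrite ?invr_ge0 // ?nnegrE ?sumr_ge0 //.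
apply: ler_sum => a _; rewrite ler_nat; case: set0Pn => //= -[x].
by rewrite inE => /andP[xA /eqP <-]; rewrite lt0b imset_f.
Qed.
End Multiscale.

(** * Bounding an integral by a step function *)

Section Integral.
Context {d} {T : measurableType d} {R : realType} (mu : {measure set T -> \bar R}).
Local Open Scope ereal_scope.

(** The integral of a nonnegative function is a supremum over the simple
    functions below it, so monotonicity holds for arbitrary sets and functions. *)
Lemma ge0_le_integral_nomeas (D E : set T) (f g : T -> \bar R) :
  D `<=` E -> (forall x, E x -> 0 <= g x) ->
  (forall x, D x -> 0 <= f x <= g x) ->
  \int[mu]_(x in D) f x <= \int[mu]_(x in E) g x.
Proof.
move=> DE g0 fg.
rewrite ge0_integralE => [|x /fg /andP[] //]; rewrite ge0_integralE //.
apply: ereal_sup_le => _ [h hf <-]; exists h => // x; apply: le_trans (hf x) _.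
rewrite /patch; case: ifPn => [xD|_].
  by move: xD; rewrite inE => xD; rewrite mem_set;
    [have /andP[]:= fg _ xD|exact: DE].
by case: ifPn => // xE; apply: g0; rewrite inE in xE.
Qed.

Lemma integral_le_sum_indic (I : finType) (c : I -> R) (B : I -> set T)
    (D : set T) (f : T -> R) :
  (forall i, 0 <= c i)%R -> (forall i, measurable (B i)) ->
  (forall x, D x -> 0 <= f x <= \sum_i c i * \1_(B i) x)%R ->
  \int[mu]_(x in D) (f x)%:E <= \sum_i (c i)%:E * mu (B i).
Proof.
move=> c0 mB fB.
apply: (@le_trans _ _ (\int[mu]_(x in setT) (\sum_i (c i * \1_(B i) x)%:E))).
  apply: ge0_le_integral_nomeas => [//|x _|x Dx].
    by apply: sume_ge0 => i _; rewrite lee_fin mulr_ge0.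
  by rewrite sumEFin !lee_fin fB.
rewrite ge0_integral_sum //; last 2 first.
- by move=> i; apply/measurable_EFinP; apply: measurable_funM.
- by move=> i x _; rewrite lee_fin mulr_ge0.
apply: lee_sum => i _.
rewrite (_ : (fun x => _) = (fun x => (c i)%:E * (\1_(B i) x)%:E)); last first.
  by apply/funext => x; rewrite EFinM.
rewrite ge0_integralZl_EFin //; last by apply/measurable_EFinP.
by rewrite integral_indic // setIT.
Qed.
End Integral.

(** * Lines, angles and cubes in coordinates *)

Section Euclid.
Context {R : realType} {n : nat}.
Implicit Types (u v x y : 'rV[R]_n).

Lemma sin_le_id (x : R) : 0 <= x -> sin x <= x.
Proof.
move=> x0.
have [c _] : exists2 c, c \in `[0, x] & sin x - sin 0 = cos c * (x - 0).
  by apply: MVT_segment => //; apply: continuous_subspaceT;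
    exact: continuous_sin.
rewrite sin0 !subr0 => ->; rewrite ler_piMl //; exact: cos_le1.
Qed.

Lemma dotrV_ge0 u : 0 <= dotrV u u.
Proof. by apply: sumr_ge0 => i _; rewrite -expr2 sqr_ge0. Qed.

Lemma coord_le_enorm u i : `|u ord0 i| <= enorm u.
Proof.
rewrite -sqrtr_sqr; apply: ler_wsqrtr; rewrite /dotrV (bigD1 i) //= expr2 lerDl.
by apply: sumr_ge0 => j _; rewrite -expr2 sqr_ge0.
Qed.

(** If c is the cosine of the angle t, then 1 - c ^ 2 = sin t ^ 2 <= t ^ 2, so
    the direction has at most the fraction (10 n)^-2 of its squared length off
    the axis. *)
Lemma angle_axis_bound (l : line R n) (j : 'I_n) : (1 < n)%N ->
  angle l (axis j) <= (10 * n%:R)^-1 ->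
  line_dir l ord0 j != 0 /\
  forall i, i != j -> `|line_dir l ord0 i / line_dir l ord0 j| <= (5 * n%:R)^-1.
Proof.
move=> n1; rewrite /angle; set d := line_dir l => hang.
have dotj : dotrV d (line_dir (axis j)) = d ord0 j.
  rewrite /dotrV (bigD1 j) //= !mxE !eqxx mulr1 big1 ?addr0 // => i ij.
  by rewrite !mxE (negbTE ij) mulr0.
have norm1 : enorm (line_dir (@axis R n j)) = 1.
  rewrite /enorm /dotrV (bigD1 j) //= !mxE !eqxx mulr1 big1 ?addr0 ?sqrtr1 // => i ij.
  by rewrite !mxE (negbTE ij) mulr0.
rewrite dotj norm1 mulr1 in hang.
set D := dotrV d d.
have D0 : 0 < D.
  rewrite lt_def dotrV_ge0 andbT; apply: contra (line_dir_neq0 l) => /eqP D0.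
  apply/eqP/rowP => i; rewrite mxE; apply/eqP.
  have := coord_le_enorm d i; rewrite /enorm -/D D0 sqrtr0.
  by rewrite normr_le0.
have E0 : 0 < enorm d by rewrite sqrtr_gt0.
have E2 : enorm d ^+ 2 = D by rewrite sqr_sqrtr // ltW.
set c := `|d ord0 j| / enorm d in hang.
have c0 : 0 <= c by rewrite divr_ge0 // ltW.
have c1 : c <= 1 by rewrite ler_pdivrMr // mul1r coord_le_enorm.
have cI : -1 <= c <= 1 by rewrite c1 andbT; lra.
have n0 : 2 <= n%:R :> R by rewrite ler_nat.
set q := (10 * n%:R)^-1 in hang *.
have q0 : 0 < q by rewrite invr_gt0; lra.
have q20 : q <= 1 / 20.
  by rewrite /q div1r lef_pV2 ?posrE; lra.
have s1 : 1 - c ^+ 2 <= q ^+ 2.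
  have a0 := acos_ge0 cI.
  have := sin_le_id a0; rewrite sin_acos // => h.
  have h2 : Num.sqrt (1 - c ^+ 2) <= q by exact: le_trans hang.
  have s0 : 0 <= 1 - c ^+ 2 by rewrite subr_ge0 expr_le1.
  by rewrite -[leLHS](sqr_sqrtr s0) lerXn2r ?nnegrE ?sqrtr_ge0 // ltW.
have cD : c ^+ 2 * D = d ord0 j ^+ 2.
  by rewrite /c expr_div_n E2 divfK ?gt_eqF // real_normK // num_real.
have dj0 : d ord0 j != 0.
  apply/eqP => dj; move: cD; rewrite dj expr0n /= => /eqP.
  by rewrite mulf_eq0 (gt_eqF D0) orbF => /eqP cc; rewrite cc in s1; nra.
split=> // i ij.
rewrite normf_div ler_pdivrMr ?normr_gt0 //.
have -> : (5 * n%:R)^-1 = 2 * q by rewrite /q; field; lra.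
suff : `|d ord0 i| ^+ 2 <= (2 * q * `|d ord0 j|) ^+ 2.
  by rewrite ler_pXn2r // nnegrE !mulr_ge0 // ltW.
rewrite exprMn !real_normK ?num_real //.
have DD : d ord0 i ^+ 2 + d ord0 j ^+ 2 <= D.
  rewrite /D /dotrV (bigD1 j) //= (bigD1 i) //= -!expr2.
  have : 0 <= \sum_(k < n | (k != j) && (k != i)) d ord0 k * d ord0 k.
    by apply: sumr_ge0 => k _; rewrite -expr2 sqr_ge0.
  lra.
have K : D * (1 - q ^+ 2) <= d ord0 j ^+ 2 by rewrite -cD mulrC;
  apply: ler_wpM2r; lra.
have q2 : q ^+ 2 <= 1 / 400 by nra.
nra.
Qed.

(** At a coordinate where |y_i| is maximal, the off-diagonal terms of y V
    contribute at most |y_i| / 5.  In other words, V is invertible and the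
    inverse has norm at most 5 / 4 for the sup norm. *)
Lemma near_identity_bound (V : 'M[R]_n) (y : 'rV[R]_n) (r : R) :
  (forall j, V j j = 1) ->
  (forall i j, i != j -> `|V j i| <= (5 * n%:R)^-1) ->
  (forall i, `|(y *m V) ord0 i| <= r) -> forall i, `|y ord0 i| <= 5 / 4 * r.
Proof.
move=> V1 Vo yV i0.
pose i := [arg max_(i > i0) `|y ord0 i|]%O.
have imax k : `|y ord0 k| <= `|y ord0 i|.
  by rewrite /i; case: arg_maxP => // k' _ /(_ k); exact.
apply: le_trans (imax i0) _.
have n0 : 0 < n%:R :> R by rewrite ltr0n (leq_trans _ (ltn_ord i0)).
have := yV i; rewrite mxE (bigD1 i) //= V1 mulr1.
set s := \sum_(_ | _) _ => h.
have hs : `|s| <= `|y ord0 i| / 5.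
  apply: le_trans (ler_norm_sum _ _ _) _.
  apply: (@le_trans _ _ (\sum_(k < n) `|y ord0 i| * (5 * n%:R)^-1)).
    rewrite [leRHS](bigD1 i) //= -[leLHS]add0r lerD // ?mulr_ge0 ?invr_ge0 ?mulr_ge0 //.
    apply: ler_sum => k ki; rewrite normrM ler_pM //.
    by apply: Vo; rewrite eq_sym.
  rewrite sumr_const card_ord -mulr_natr le_eqVlt; apply/orP; left; apply/eqP.
  by field; rewrite gt_eqF.
have := ler_normB (y ord0 i + s) s; rewrite addrK; lra.
Qed.

(** The entries of an orthogonal matrix are at most 1 in absolute value. *)
Lemma cube_coord_bound (S : R) (Q : set 'rV[R]_n) : 0 <= S -> is_cube S Q ->
  exists c : 'rV[R]_n, forall x, Q x -> forall i, `|(x - c) ord0 i| <= n%:R * S.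
Proof.
move=> S0 [c [U [UU ->]]]; exists c => _ [t /= tS <-] i.
rewrite [_ - c](_ : _ = t *m U); last by rewrite addrC addKr.
rewrite mxE; apply: le_trans (ler_norm_sum _ _ _) _.
apply: (@le_trans _ _ (\sum_(k < n) S));
  last by rewrite sumr_const card_ord mulr_natl.
apply: ler_sum => k _; rewrite normrM -[leRHS]mulr1 ler_pM //.
  by have /andP[t0 t1] := tS k; rewrite ger0_norm.
have : \sum_l U k l ^+ 2 = 1.
  have /matrixP/(_ k k) := UU; rewrite !mxE eqxx => UUk; apply: etrans UUk.
  by apply: eq_bigr => l _; rewrite mxE expr2.
rewrite (bigD1 i) //= => h.
have : 0 <= \sum_(l < n | l != i) U k l ^+ 2 by apply: sumr_ge0 => l _;
  exact: sqr_ge0.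
by rewrite -(@expr_le1 _ 2) // real_normK ?num_real //; lra.
Qed.

(** The infimum defining the distance need not be known to be attained: a point
    of the line at distance less than 2 is enough. *)
Lemma nbhd_line_point (l : line R n) x : nbhd 1 (line_points l) x ->
  exists t, forall i, `|(x - (line_base l + t *: line_dir l)) ord0 i| <= 2.
Proof.
rewrite /nbhd /= /edist => h.
have : (ereal_inf [set (enorm (x - y))%:E | y in line_points l] < 2%:E)%E.
  by apply: le_lt_trans h _; rewrite lte_fin; lra.
move=> /ereal_inf_lt [_ [y [t _ <-] <-]]; rewrite lte_fin => /ltW h2.
by exists t => i; apply: le_trans (coord_le_enorm _ _) h2.
Qed.
End Euclid.

(** * Sorting slopes into caps *)

Section Caps.
Context {R : realType} {n : nat}.

(** The slopes have coordinates in [-1, 1]; each one is rounded to a multiple of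
    1 / m. *)
Definition cap (m : nat) (u : 'rV[R]_n) : {ffun 'I_n -> 'I_(2 * m).+1} :=
  [ffun i => inord (Num.truncn ((u ord0 i + 1) * m%:R))].

Lemma cap_close m (u v : 'rV[R]_n) : (0 < m)%N ->
  (forall i, `|u ord0 i| <= 1) -> (forall i, `|v ord0 i| <= 1) ->
  cap m u = cap m v -> forall i, `|u ord0 i - v ord0 i| <= m%:R^-1.
Proof.
move=> m0 u1 v1 uv i; have m0' : 0 < m%:R :> R by rewrite ltr0n.
have H (w : 'rV[R]_n) : (forall i, `|w ord0 i| <= 1) ->
    (cap m w i)%:R <= (w ord0 i + 1) * m%:R < (cap m w i)%:R + 1.
  move=> /(_ i); rewrite ler_norml => /andP[w1 w2].
  have z0 : 0 <= (w ord0 i + 1) * m%:R by rewrite mulr_ge0 //; lra.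
  rewrite ffunE inordK; first by rewrite natr1 truncn_itv.
  rewrite ltnS -(ler_nat R); apply: (@le_trans _ _ ((w ord0 i + 1) * m%:R)).
    by rewrite truncn_le.
  by rewrite natrM ler_wpM2r //; lra.
have := H _ u1; have := H _ v1; rewrite uv => /andP[a1 a2] /andP[b1 b2].
rewrite -[leRHS]mul1r ler_pdivlMr // -[m%:R in leLHS]gtr0_norm // -normrM.
rewrite ler_norml mulrBl; rewrite !mulrDl in a1 a2 b1 b2; lra.
Qed.
End Caps.

(** * The grid along a frame close to the axes *)

Section Frame.
Context {R : realType} {n : nat} (V : 'M[R]_n) (o : 'rV[R]_n).
Context (V1 : forall j, V j j = 1).
Context (Vo : forall i j, i != j -> `|V j i| <= (5 * n%:R)^-1).

Definition node m (w : {ffun 'I_n -> 'I_m}) : 'rV[R]_n :=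
  o + (\row_i (w i)%:R) *m V.

(** Boxes parallel to the original axes, rather than cells of the slanted grid:
    they overlap, but their measure is immediate and they cover. *)
Definition box m (w : {ffun 'I_n -> 'I_m}) : set 'rV[R]_n :=
  [set x | forall i, `|(x - node w) ord0 i| <= 2].

Lemma boxE m (w : {ffun 'I_n -> 'I_m}) : box w =
  [set x | forall i, `[node w ord0 i - 2, node w ord0 i + 2]%classic (x ord0 i)].
Proof.
apply/seteqP; split => x /= h i; have := h i;
  rewrite /= !mxE ler_norml in_itv /=; lra.
Qed.

Lemma measurable_box m (w : {ffun 'I_n -> 'I_m}) : measurable (box w).
Proof.
rewrite boxE [X in measurable X](_ : _ = \bigcap_(i in [set: 'I_n])
   ((fun x : 'rV[R]_n => x ord0 i) @^-1` `[node w ord0 i - 2, node w ord0 i + 2]%classic)).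
  apply: fin_bigcap_measurable => // i _.
  by rewrite -[X in measurable X]setTI; exact: measurable_rV_coord.
by apply/seteqP; split => x /= h i *; exact: h.
Qed.

Lemma lebesgue_box m (w : {ffun 'I_n -> 'I_m}) : lebesgue_rV R n (box w) = (4 ^+ n)%:E.
Proof.
rewrite boxE (@lebesgue_rV_box R n
  (fun i => `[node w ord0 i - 2, node w ord0 i + 2]%classic)) => [|i //].
rewrite (eq_bigr (fun=> 4%:E)) => [|i _].
  by rewrite prodEFin prodr_const card_ord.
rewrite lebesgue_measure_itv /= lte_fin ifT; last by lra.
by rewrite -EFinD; congr EFin; lra.
Qed.

Lemma frame_unitmx : V \in unitmx.
Proof.
rewrite -row_free_unit; apply: inj_row_free => v vV.
have := @near_identity_bound R n V v 0 V1 Vo; rewrite vV mulr0 => h.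
apply/rowP => i; rewrite mxE; apply/eqP; rewrite -normr_le0; apply: h => k.
by rewrite mxE normr0.
Qed.

(** The frame coordinates of x - c are at most 2 s, so after translation by 2 s
    they are in [0, 4 s], and rounding them down moves the point by at most
    1 + 1 / 5 in each coordinate. *)
Lemma frame_cover m (c x : 'rV[R]_n) (s : R) :
  o = c - const_mx (2 * s) *m V -> 4 * s < m%:R ->
  (forall i, `|(x - c) ord0 i| <= s) ->
  exists w : {ffun 'I_n -> 'I_m}, box w x.
Proof.
move=> oE sm xc.
pose y := (x - c) *m invmx V.
have yV : y *m V = x - c by rewrite /y mulmxKV // frame_unitmx.
have yb i : `|y ord0 i| <= 2 * s.
  apply: (@le_trans _ _ (5 / 4 * s)).
    by apply: near_identity_bound i => // k; rewrite yV.
  by have := le_trans (normr_ge0 _) (xc i); lra.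
have z0 i : 0 <= y ord0 i + 2 * s by have := yb i; rewrite ler_norml; lra.
have zm i : (Num.truncn (y ord0 i + 2 * s) < m)%N.
  by rewrite truncn_lt_nat //; have := yb i; rewrite ler_norml; lra.
exists [ffun i => Ordinal (zm i)] => i.
pose r : 'rV[R]_n := \row_k (y ord0 k + 2 * s - (Num.truncn (y ord0 k + 2 * s))%:R).
have -> : x - node [ffun i => Ordinal (zm i)] = r *m V.
  rewrite /node oE (_ : r = y + const_mx (2 * s) - \row_k (Num.truncn (y ord0 k + 2 * s))%:R).
    rewrite mulmxBl mulmxDl yV (_ : \row_i ([ffun i => Ordinal (zm i)] i)%:R =
      \row_k (Num.truncn (y ord0 k + 2 * s))%:R).
      by apply/rowP => k; rewrite !mxE; ring.
    by apply/rowP => k; rewrite [LHS]mxE [RHS]mxE ffunE.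
  by apply/rowP => k; rewrite !mxE.
have rb k : `|r ord0 k| <= 1.
  by have := truncn_itv (z0 k);
    rewrite [r _ _]mxE -natr1 ler_norml => /andP[h1 h2]; apply/andP; split; lra.
have n0 : 0 < n%:R :> R by rewrite ltr0n (leq_trans _ (ltn_ord i)).
rewrite mxE; apply: le_trans (ler_norm_sum _ _ _) _.
rewrite (bigD1 i) //= V1 mulr1.
have -> : 2 = 1 + 1 :> R by lra.
apply: lerD => //; apply: (@le_trans _ _ (\sum_(k < n) (5 * n%:R)^-1)).
  rewrite [leRHS](bigD1 i) //= -[leLHS]add0r lerD // ?invr_ge0 ?mulr_ge0 //.
  apply: ler_sum => k ki; rewrite normrM -[leRHS]mul1r ler_pM //.
  by apply: Vo; rewrite eq_sym.
rewrite sumr_const card_ord -[leLHS]mulr_natr.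
have -> : (5 * n%:R)^-1 * n%:R = 1 / 5 :> R by field; rewrite gt_eqF.
lra.
Qed.

(** The nodes whose box meets the 2-neighborhood, in the sup norm, of the line
    through b with direction u. *)
Definition trace m (b u : 'rV[R]_n) : {set {ffun 'I_n -> 'I_m}} :=
  [set w | `[< exists x t, box w x /\ forall i, `|(x - (b + t *: u)) ord0 i| <= 2 >]].

(** Two nodes of the trace differ by s u up to an error at most 8, where s is the
    difference of the parameters on the line.  Since u is within 1 / (4 L) of
    the j-th frame vector, the frame coordinates of the difference are those of
    s e_j up to 5 / 4 (8 + |s| / (4 L)); the j-th one bounds |s|. *)
Lemma rough_lip_trace m L j (b u : 'rV[R]_n) : (0 < L)%N ->
  (forall i, `|u ord0 i - V j i| <= (4 * L)%:R^-1) ->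
  rough_lip L 20 j (trace m b u).
Proof.
move=> L0 uV w w'; rewrite !inE => -[x [t [xw xt]]] -[x' [t' [xw' xt']]] i ij.
have L0' : 1 <= L%:R :> R by rewrite ler1n.
pose s := t - t'.
pose y : 'rV[R]_n := \row_k (w k)%:R - \row_k (w' k)%:R - s *: delta_mx ord0 j.
have yb : forall k, `|y ord0 k| <= 5 / 4 * (8 + `|s| * (4 * L)%:R^-1).
  apply: near_identity_bound => // k.
  have -> : (y *m V) ord0 k = (x - (b + t *: u)) ord0 k - (x' - (b + t' *: u)) ord0 k
     - (x - node w) ord0 k + (x' - node w') ord0 k + s * (u ord0 k - V j k).
    rewrite /y !mulmxBl -scalemxAl -rowE /node !mxE /s.
    move: (\sum_(_ < _) _) (\sum_(_ < _) _) => A B; ring.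
  have := xw k; have := xw' k; have := xt k; have := xt' k.
  have : `|s * (u ord0 k - V j k)| <= `|s| * (4 * L)%:R^-1 by rewrite normrM ler_wpM2l.
  rewrite !ler_norml; lra.
pose q : R := `|s| / L%:R.
have qE : `|s| * (4 * L)%:R^-1 = q / 4 by rewrite /q natrM; field; lra.
have qL : q * L%:R = `|s| by rewrite /q divfK //; lra.
have q0 : 0 <= q by rewrite /q divr_ge0.
rewrite qE in yb.
have yj : y ord0 j = (w j)%:R - (w' j)%:R - s by rewrite !mxE !eqxx mulr1.
have yi : y ord0 i = (w i)%:R - (w' i)%:R by rewrite !mxE eqxx (negbTE ij) mulr0 subr0.
have := yb i; have := yb j; rewrite yi yj => hj hi.
rewrite -(ler_nat R) !natrD !natrM.
set D : R := ((w j - w' j)%:R + (w' j - w j)%:R).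
have DE : D = `|(w j)%:R - (w' j)%:R|.
  rewrite /D; have [h|h] := leqP (w j) (w' j).
    by rewrite (eqP (h : (w j - w' j)%N == 0%N)) add0r natrB // ler0_norm ?opprB // subr_le0 ler_nat.
  rewrite natrB ?(ltnW h) // (eqP (ltnW h : (w' j - w j)%N == 0%N)) addr0 ger0_norm //.
  by rewrite subr_ge0 ler_nat ltnW.
have sD : `|s| <= D + 5 / 4 * (8 + q / 4).
  rewrite DE -[s](subKr ((w j)%:R - (w' j)%:R)).
  apply: le_trans (ler_normB _ _) _; rewrite lerD2l; exact: hj.
rewrite -addrA -/D.
move: hi; rewrite ler_norml => /andP[_ hi].
have hiL : L%:R * ((w i)%:R - (w' i)%:R) <= L%:R * (5 / 4 * (8 + q / 4)) by rewrite ler_wpM2l //; lra.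
nra.
Qed.
End Frame.

(** * From the integral to the grid *)

Unset Implicit Arguments.

Section Assembly.
Context {R : realType} {n : nat}.
Context (n1 : (1 < n)%N).
Context (N : 'I_n -> nat) (l : forall j : 'I_n, 'I_(N j) -> line R n).
Context (hang : forall (j : 'I_n) (a : 'I_(N j)),
  angle (l j a) (axis j) <= (10 * n%:R)^-1).
Context (L : nat) (L1 : (1 < L)%N).

Let r : R := n.-1%:R^-1.
Let T j a x : R := \1_(nbhd 1 (line_points (l j a))) x.

Definition slope j (a : 'I_(N j)) : 'rV[R]_n :=
  (line_dir (l j a) ord0 j)^-1 *: line_dir (l j a).

Lemma slope_axis j a : slope j a ord0 j = 1.
Proof. by rewrite mxE mulVf //; case: (angle_axis_bound n1 (hang j a)). Qed.

Lemma slope_off j a i : i != j -> `|slope j a ord0 i| <= (5 * n%:R)^-1.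
Proof. by move=> ij; rewrite mxE mulrC;
  case: (angle_axis_bound n1 (hang j a)) => _; apply. Qed.

Lemma slope_le1 j a i : `|slope j a ord0 i| <= 1.
Proof.
have [->|/(slope_off j a) h] := eqVneq i j; first by rewrite slope_axis normr1.
apply: le_trans h _; rewrite invf_le1.
  by rewrite -natrM ler1n muln_gt0 /= ltnW.
by rewrite -natrM ltr0n muln_gt0 /= ltnW.
Qed.

Lemma tube_point j a x : nbhd 1 (line_points (l j a)) x ->
  exists t, forall i, `|(x - (line_base (l j a) + t *: slope j a)) ord0 i| <= 2.
Proof.
move=> /nbhd_line_point[t h]; exists (t * line_dir (l j a) ord0 j) => i.
rewrite /slope scalerA -mulrA mulfV ?mulr1 //.
by case: (angle_axis_bound n1 (hang j a)).
Qed.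

Local Notation caps := {ffun 'I_n -> 'I_(2 * (4 * L)).+1}.

(** One slope from each chosen cap, so that the frame vectors are close to the
    axes even if the cap reaches beyond the slopes allowed by the angle;
      an empty
    cap contributes no tube, and the axis itself will do. *)
Definition frame (k : {ffun 'I_n -> caps}) : 'M[R]_n := \matrix_j
  if [pick a | cap (4 * L) (slope j a) == k j] is Some a then slope j a
  else delta_mx ord0 j.

Lemma frame_diag k j : frame k j j = 1.
Proof.
rewrite mxE; case: pickP => [a _|_]; first exact: slope_axis.
by rewrite mxE !eqxx.
Qed.

Lemma frame_off k i j : i != j -> `|frame k j i| <= (5 * n%:R)^-1.
Proof.
move=> ij; rewrite mxE; case: pickP => [a _|_]; first exact: slope_off.
by rewrite mxE (negbTE ij) andbF normr0 invr_ge0 mulr_ge0.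
Qed.

Lemma slope_frame (k : {ffun 'I_n -> caps}) j a i : cap (4 * L) (slope j a) = k j ->
  `|slope j a ord0 i - frame k j i| <= (4 * L)%:R^-1.
Proof.
move=> ak; rewrite [frame _ _ _]mxE; case: pickP => [b /eqP bk|/(_ a)];
  last by rewrite ak eqxx.
apply: cap_close; rewrite ?ak ?bk //; [|exact: slope_le1|exact: slope_le1].
by rewrite muln_gt0 /= ltnW.
Qed.

(** Tubes out of the chosen cap are given an empty trace, which keeps the number
    of sets equal to N j. *)
Definition cap_trace (c : 'rV[R]_n) (s : R) m (k : {ffun 'I_n -> caps}) j a :
    {set {ffun 'I_n -> 'I_m}} :=
  if cap (4 * L) (slope j a) == k j then
    trace (frame k) (c - const_mx (2 * s) *m frame k) m (line_base (l j a)) (slope j a)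
  else finset.set0.

(** Split the j-th sum according to caps, apply subadditivity of the power, and
    expand the product. *)
Lemma sum_caps_le x :
  \prod_(j < n) (\sum_(a < N j) T j a x) `^ r <=
  \sum_(k : {ffun 'I_n -> caps})
    \prod_(j < n) (\sum_(a < N j | cap (4 * L) (slope j a) == k j) T j a x) `^ r.
Proof.
have T0 j a : 0 <= T j a x by rewrite /T indicE.
have n0 : (0 < n.-1)%N by case: (n) n1 => [|[]].
have r0 : 0 < r by rewrite invr_gt0 ltr0n.
have r1 : r <= 1 by rewrite invf_le1 ?ler1n ?ltr0n.
rewrite -(bigA_distr_bigA (fun j (kj : caps) =>
  (\sum_(a < N j | cap (4 * L) (slope j a) == kj) T j a x) `^ r)).
apply: ler_prod => j _; rewrite powR_ge0 /=.
rewrite (partition_big (fun a => cap (4 * L) (slope j a)) xpredT) //=.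
by apply: powR_sum_le => // kj; exact: sumr_ge0.
Qed.

Lemma tubes_le_trace (c x : 'rV[R]_n) (s : R) m
    (k : {ffun 'I_n -> caps}) :
  4 * s < m%:R ->
  (forall i, `|(x - c) ord0 i| <= s) ->
  \prod_(j < n) (\sum_(a < N j | cap (4 * L) (slope j a) == k j) T j a x) `^ r <=
  \sum_(w : {ffun 'I_n -> 'I_m})
    (\prod_(j < n) (\sum_(a < N j) (w \in cap_trace c s m k j a)%:R) `^ r) *
    \1_(box (frame k) (c - const_mx (2 * s) *m frame k) w) x.
Proof.
move=> sm xc; set o := c - _.
have r0 : 0 <= r by rewrite invr_ge0.
have [w xw] := frame_cover (frame_diag k) (frame_off k) (erefl o) sm xc.
rewrite (bigD1 w) //= indicE mem_set // mulr1 -[leLHS]addr0 lerD //; last first.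
  apply: sumr_ge0 => w' _; rewrite mulr_ge0 ?indicE //.
  by apply: prodr_ge0 => j _; exact: powR_ge0.
apply: ler_prod => j _; rewrite powR_ge0 /=.
have T0 a : 0 <= T j a x by rewrite /T indicE.
apply: ge0_ler_powR => //; rewrite ?nnegrE ?sumr_ge0 //.
rewrite big_mkcond /=; apply: ler_sum => a _; rewrite /cap_trace.
case: ifP => // _; rewrite /T indicE ler_nat.
case: (boolP (x \in _)) => //= xT; rewrite lt0b /trace finset.in_set.
move: xT; rewrite inE => /tube_point[t xt].
by apply/asboolP; exists x, t.
Qed.

Lemma cap_trace_rough c s m k j a : rough_lip L 20 j (cap_trace c s m k j a).
Proof.
rewrite /cap_trace; case: eqP => [ak|_]; last by move=> p q; rewrite inE.
apply: rough_lip_trace => [i|i ij||i];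
  [exact: frame_diag|exact: frame_off|exact: ltnW|].
exact: slope_frame.
Qed.

(** Here 43 = 2 (20 + 1) + 1, as traces are roughly Lipschitz with constant 20,
    and 4 ^ n is the measure of a box. *)
Lemma kakeya_integral_le (S : R) (Q : set 'rV[R]_n) M : 0 <= S -> is_cube S Q ->
  4 * (n%:R * S) < (L ^ M)%:R ->
  (\int[lebesgue_rV R n]_(x in Q) (\prod_(j < n) (\sum_(a < N j) T j a x) `^ r)%:E <=
   (#|{ffun 'I_n -> caps}|%:R * 4 ^+ n * (43 ^ n)%:R ^+ M *
     \prod_(j < n) (N j)%:R `^ r)%:E)%E.
Proof.
move=> S0 /(cube_coord_bound S0)[c Qc]; set s := n%:R * S in Qc * => sM.
pose F k (w : {ffun 'I_n -> 'I_(L ^ M)}) : R :=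
  \prod_(j < n) (\sum_(a < N j) (w \in cap_trace c s (L ^ M) k j a)%:R) `^ r.
have F0 k w : 0 <= F k w by apply: prodr_ge0 => j _; exact: powR_ge0.
pose o k := c - const_mx (2 * s) *m frame k.
pose I := ({ffun 'I_n -> caps} * {ffun 'I_n -> 'I_(L ^ M)})%type.
apply: le_trans (@integral_le_sum_indic _ _ R (lebesgue_rV R n) I (fun p => F p.1 p.2)
  (fun p => box (frame p.1) (o p.1) p.2) _ _ _ _ _) _.
- by move=> p; exact: F0.
- by move=> p; exact: measurable_box.
- move=> x Qx; rewrite prodr_ge0 => [|j _]; last exact: powR_ge0.
  rewrite /= -(pair_big xpredT xpredT (fun k w => F k w * \1_(box (frame k) (o k) w) x)) /=.
  apply: le_trans (sum_caps_le x) _; apply: ler_sum => k _.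
  exact: (tubes_le_trace _ _ _ _ _ sM (Qc x Qx)).
rewrite (eq_bigr (fun p : I => (F p.1 p.2 * 4 ^+ n)%:E)); last first.
  by move=> p _; rewrite EFinM; congr (_ * _)%E; exact: lebesgue_box.
rewrite sumEFin lee_fin -mulr_suml.
rewrite -(pair_big xpredT xpredT (fun k w => F k w)) /=.
rewrite [leRHS](_ : _ = (\sum_(k : {ffun 'I_n -> caps})
   ((43 ^ n)%:R ^+ M * \prod_(j < n) (N j)%:R `^ r)) * 4 ^+ n); last first.
  by rewrite sumr_const -mulr_natl; ring.
rewrite ler_wpM2r ?exprn_ge0 //; apply: ler_sum => k _.
exact: (@kakeya_sum_multiscale R n n1 L 20 M N _ L1 isT
  (fun j a => cap_trace_rough c s (L ^ M) k j a)).
Qed.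
End Assembly.

(** * Multilinear Kakeya *)

Theorem theorem1 (R : realType) (n : nat) (hn : (2 <= n)%N)
    (eps : R) (heps : 0 < eps) :
  exists C : R,
    forall (N : 'I_n -> nat) (l : forall j : 'I_n, 'I_(N j) -> line R n),
      (forall (j : 'I_n) (a : 'I_(N j)),
        angle (l j a) (axis j) <= (10 * n%:R)^-1) ->
      forall (S : R) (Q : set 'rV[R]_n), 1 <= S -> is_cube S Q ->
        (\int[lebesgue_rV R n]_(x in Q)
           (\prod_(j < n)
              (\sum_(a < N j) \1_(nbhd 1 (line_points (l j a))) x)
                `^ (n%:R - 1)^-1)%:E
         <= (C * S `^ eps * \prod_(j < n) (N j)%:R `^ (n%:R - 1)^-1)%:E)%E.
Proof.
have [L L1 LK] := @exists_scale R eps (43 ^ n)%:R heps (ler0n _ _).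
have n0 : 1 <= n%:R :> R by rewrite ler1n ltnW.
have -> : n%:R - 1 = n.-1%:R :> R by rewrite -[in LHS](ltn_predK hn) -natr1 addrK.
(* The number of choices of caps, the measure of a box, and the bound
   L 4 n S on the side of the grid, raised to eps and with S taken out. *)
exists (#|{ffun 'I_n -> {ffun 'I_n -> 'I_(2 * (4 * L)).+1}}|%:R * 4 ^+ n *
  (L%:R * (4 * n%:R)) `^ eps) => N l hang S Q S1 cQ.
have [|M /andP[M1 M2]] := @exists_power R L (4 * (n%:R * S)) L1; first by nra.
apply: le_trans (kakeya_integral_le hn _ _ hang _ L1 _ _ _ _ cQ M1) _;
  first by lra.
rewrite lee_fin ler_wpM2r //; first by apply: prodr_ge0 => j _; exact: powR_ge0.
rewrite -[leRHS]mulrA ler_wpM2l //.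
apply: (@le_trans _ _ ((L%:R `^ eps) ^+ M));
  first by rewrite lerXn2r ?nnegrE ?powR_ge0.
rewrite -powR_mulrn ?powR_ge0 // powRAC powR_mulrn // -natrX -powRM ?mulr_ge0 //; try lra.
apply: ge0_ler_powR; rewrite ?nnegrE ?(ltW heps) ?mulr_ge0 //; try lra.
Qed.
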